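(* Let $\delta>0$ be a constant. There does not exist a generalized locally optimal algorithm for weighted token swapping on general graphs which, on every instance, outputs a valid solution of cost at most $\left(2+\frac{2W}{w}-\delta\right)\cdot\mathrm{OPT}$, where $w$ and $W$ are the minimum and maximum token weights of the instance.
   Context: An instance of weighted token swapping consists of a connected simple undirected graph $G=(V,E)$ with $n=|V|$ vertices, a set $T$ of $n$ tokens, a weight function $\omega:T\to\mathbb{R}_{>0}$, and two bijections $v_0,v_f:T\to V$ (starting and destination vertices). At all times each vertex holds exactly one token; initially token $t$ is on $v_0(t)$. A swap along an edge $(u,u')\in E$ exchanges the tokens on $u$ and $u'$ and costs the sum of the weights of the two swapped tokens. A valid solution is a sequence of swaps after which every token $t$ is on $v_f(t)$; its cost is the sum of the costs of its swaps, and $\mathrm{OPT}$ is the minimum cost of a valid solution. An algorithm is generalized locally optimal if every swap it performs strictly decreases, for at least one of the two participating tokens $t$, the graph distance from the current vertex of $t$ to $v_f(t)$ or the graph distance from the current vertex of $t$ to $v_0(t)$. *)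

(* Defs.v *)
From HB Require Import structures.
From mathcomp Require Import all_boot all_order all_fingroup all_algebra.
From mathcomp Require Import all_classical all_reals.

Set Implicit Arguments.
Unset Strict Implicit.
Unset Printing Implicit Defensive.

Import Order.TTheory GRing.Theory Num.Theory.

Local Open Scope ring_scope.

(* #|token| = #|vertex| follows from either bijection. *)
Record instance (R : realType) := Instance {
  vertex : finType;
  adj : rel vertex;
  adj_sym : symmetric adj;
  adj_irr : irreflexive adj;
  adj_conn : forall x y, connect adj x y;
  vertex_gt0 : (0 < #|vertex|)%N;
  token : finType;
  weight : token -> R;
  weight_gt0 : forall t, 0 < weight t;
  start : token -> vertex;
  start_bij : bijective start;
  dest : token -> vertex;
  dest_bij : bijective dest
}.

Arguments adj {R} i.
Arguments weight {R} i.
Arguments start {R} i.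
Arguments dest {R} i.

Section TokenSwapping.
Variables (R : realType) (I : instance R).

Local Notation V := (vertex I).
Local Notation T := (token I).

Definition walk_length (x y : V) (k : nat) : bool :=
  [exists p : k.-tuple V, path (adj I) x p && (last x p == y)].

Lemma walk_length_exists (x y : V) : exists k, walk_length x y k.
Proof.
have /connectP[p pP ->] := adj_conn x y.
exists (size p); apply/existsP; exists (in_tuple p).
by rewrite pP eqxx.
Qed.

Definition gdist (x y : V) : nat := ex_minn (walk_length_exists x y).

Definition position : Type := T -> V.

(* The swap (u, u') exchanges the tokens on u and u'. *)
Definition do_swap (p : position) (e : V * V) : position :=
  fun t => tperm e.1 e.2 (p t).

Definition participates (p : position) (e : V * V) (t : T) : bool :=
  (p t == e.1) || (p t == e.2).

Definition swap_cost (p : position) (e : V * V) : R :=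
  \sum_(t | participates p e t) weight I t.

Definition run (p : position) (s : seq (V * V)) : position :=
  foldl do_swap p s.

Fixpoint run_cost (p : position) (s : seq (V * V)) : R :=
  if s is e :: s' then swap_cost p e + run_cost (do_swap p e) s' else 0.

Definition cost (s : seq (V * V)) : R := run_cost (start I) s.

Definition valid_solution (s : seq (V * V)) : Prop :=
  (forall e, e \in s -> adj I e.1 e.2) /\
  (forall t, run (start I) s t = dest I t).

(* A minimum, by OPT_attained. *)
Definition OPT : R := inf [set cost s | s in valid_solution]%classic.

Definition gen_locally_optimal_swap (p : position) (e : V * V) : Prop :=
  exists t, participates p e t /\
    ((gdist (do_swap p e t) (dest I t) < gdist (p t) (dest I t))%N \/
     (gdist (do_swap p e t) (start I t) < gdist (p t) (start I t))%N).

Fixpoint gen_locally_optimal_from (p : position) (s : seq (V * V)) : Prop :=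
  if s is e :: s' then
    gen_locally_optimal_swap p e /\ gen_locally_optimal_from (do_swap p e) s'
  else True.

Definition gen_locally_optimal (s : seq (V * V)) : Prop :=
  gen_locally_optimal_from (start I) s.

(* The neutral elements are harmless: weights are positive and at most
   max_weight, and there is at least one token. *)
Definition max_weight : R := \big[Order.max/0]_(t : T) weight I t.
Definition min_weight : R := \big[Order.min/max_weight]_(t : T) weight I t.

Lemma run_cat p s1 s2 : run p (s1 ++ s2) = run (run p s1) s2.
Proof. exact: foldl_cat. Qed.

Lemma tperm_by_swaps (x y : V) : exists s : seq (V * V),
  (forall e, e \in s -> adj I e.1 e.2) /\
  (forall p t, run p s t = tperm x y (p t)).
Proof.
have /connectP[q qP ->] := adj_conn x y.
elim: q x qP => [|z q IH] x /=; first by exists [::]; split=> // p t /=; rewrite tperm1 perm1.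
case/andP=> xz /IH[s [sP sE]].
case: (eqVneq x (last z q)) => [<-|xl].
  by exists [::]; split=> // p t /=; rewrite tperm1 perm1.
case: (eqVneq z (last z q)) => [<-|zl].
  by exists [:: (x, z)]; split=> [e|//]; rewrite inE => /eqP->.
exists ((x, z) :: s ++ [:: (x, z)]); split=> [e|p t].
  by rewrite inE mem_cat inE => /orP[/eqP->//|/orP[/sP//|/eqP->]].
have -> : run p ((x, z) :: s ++ [:: (x, z)]) t
    = run (run (do_swap p (x, z)) s) [:: (x, z)] t by rewrite -run_cat.
rewrite {1}/run /= {1}/do_swap sE /do_swap /=.
set l := last z q in xl zl *; set a := p t.
have -> : tperm x l = (tperm z l ^ tperm x z)%g.
  by rewrite tpermJ tpermR tpermD.
by rewrite conjgE tpermV !permM.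
Qed.

Lemma perm_by_swaps (g : {perm V}) : exists s : seq (V * V),
  (forall e, e \in s -> adj I e.1 e.2) /\
  (forall p t, run p s t = g (p t)).
Proof.
have [ts -> _] := prod_tpermP g.
elim: ts => [|[x y] ts [s [sP sE]]].
  by exists [::]; split=> // p t; rewrite big_nil perm1.
have [s1 [s1P s1E]] := tperm_by_swaps x y.
exists (s1 ++ s); split=> [e|p t].
  by rewrite mem_cat => /orP[/s1P|/sP].
by rewrite run_cat sE s1E big_cons permM.
Qed.

Lemma valid_solution_exists : exists s, valid_solution s.
Proof.
have [f fK Kf] := start_bij I.
have inj : injective (dest I \o f).
  by apply: inj_comp; [exact: bij_inj (dest_bij I)|exact: can_inj Kf].
have [s [sP sE]] := perm_by_swaps (perm inj).
by exists s; split=> // t; rewrite sE permE /= fK.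
Qed.

Lemma run_cost_ge (p : position) (s : seq (V * V)) (m : R) :
  0 <= m -> (forall t, m <= weight I t) -> bijective p ->
  m * (size s)%:R <= run_cost p s.
Proof.
move=> m0 mP; elim: s p => [|e s IH] p pb /=; first by rewrite mulr0.
rewrite -natr1 mulrDr mulr1 addrC lerD//; last first.
  by apply: IH; apply: bij_comp pb; exact: injF_bij (@perm_inj _ _).
have [f _ Kf] := pb.
rewrite /swap_cost (bigD1 (f e.1)) /participates ?Kf ?eqxx //=.
apply: le_trans (mP (f e.1)) _.
by rewrite lerDl sumr_ge0 // => t _; rewrite ltW ?weight_gt0.
Qed.

Lemma OPT_attained :
  exists2 s, valid_solution s &
    cost s = OPT /\ forall s', valid_solution s' -> OPT <= cost s'.
Proof.
suff [s vs sm] : exists2 s, valid_solution s &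
    forall s', valid_solution s' -> cost s <= cost s'.
  have lb s' : valid_solution s' -> OPT <= cost s'.
    move=> vs'; apply: ge_inf; last by exists s'.
    by exists (cost s) => _ [r vr <-]; exact: sm.
  exists s => //; split=> //; apply/eqP; rewrite eq_le (lb _ vs) andbT.
  apply: lb_le_inf; first by exists (cost s); exists s.
  by move=> _ [r vr <-]; exact: sm.
have [s0 v0] := valid_solution_exists.
have [t0 _] : exists t0 : T, True.
  have [f _ _] := start_bij I.
  by have /card_gt0P[x _] := vertex_gt0 I; exists (f x).
pose tm := [arg min_(t < t0) weight I t]%O.
have tmP t : weight I tm <= weight I t by rewrite /tm; case: arg_minP => // i _; apply.
have m0 : 0 < weight I tm := weight_gt0 tm.
pose K := (Num.truncn (cost s0 / weight I tm)).+1.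
have short s : cost s <= cost s0 -> (size s <= K)%N.
  move=> ss0; have := le_trans (run_cost_ge s (ltW m0) tmP (start_bij I)) ss0.
  rewrite mulrC -ler_pdivlMr // => h.
  by rewrite -(ler_nat R) (le_trans h) // ltW // truncnS_gt.
pose b0 := Bseq (short s0 (lexx _)).
pose P (b : K.-bseq (V * V)) := `[< valid_solution b >].
have Pb0 : P b0 by apply/asboolP.
case: (arg_minP (fun b : K.-bseq (V * V) => cost b) Pb0) => b /asboolP vb bm.
exists b => // s' vs'; have [le|/ltW le] := leP (cost s') (cost s0).
  by apply: (bm (Bseq (short _ le))); apply/asboolP.
by apply: le_trans le; exact: (bm b0).
Qed.

End TokenSwapping.

(* Main.v *)
Require Import Defs.
From mathcomp Require Import all_boot all_order all_fingroup all_algebra.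
From mathcomp Require Import all_classical all_reals.
From mathcomp Require Import zify lra.

(** With unit weights the claimed ratio is 4 - delta. Take M branch vertices
    x_i, joined pairwise by paths with L edges, the token of x_i having
    destination x_{i+1} and all other tokens being at home. Sorting this graph
    takes about 2ML swaps. Indeed, in a shortest solution no two tokens are
    swapped twice (else delete both swaps), so few swaps take place inside the
    set of O(M) tokens that have to move or make at least L moves. For a
    position c, look at the c-th edges of all paths. The paths used there
    connect all branch vertices, hence are at least M - 1 in number, and,
    unless a swap inside that set takes place at position c, each is used at
    least twice: another token returns home in less than L moves, so
    it crosses the c-th edge of any given path an even number of times.

    Now take many copies of this graph, and attach to all copies of x_i one
    common leg with L/2 + 1 vertices, where the ends of the M legs form a
    clique. All tokens on the legs are at home, and the legs never give a
    shortcut between vertices of one copy, so a generalized locally optimal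
    algorithm never uses them and pays 2ML swaps per copy. But through the legs,
    tokens travelling inwards are swapped with tokens travelling outwards, so
    that nearly all swaps bring two tokens closer to their destinations: about
    ML/2 swaps per copy. *)

Set Implicit Arguments.
Unset Strict Implicit.
Unset Printing Implicit Defensive.

Import Order.TTheory GRing.Theory Num.Theory.

(** * Subdivided complete graphs *)

Section SubdividedCompleteGraph.
Variables m l : nat.

(** There is one path for every ordered pair of branch vertices, loops included; with [l] interior
    vertices it has [l.+1] edges, which the last component of a [label] numbers. *)
Definition cvert : finType := ('I_m.+1 + 'I_m.+1 * 'I_m.+1 * 'I_l)%type.
Definition label : finType := ('I_m.+1 * 'I_m.+1 * 'I_l.+1)%type.

Definition pt (e : 'I_m.+1 * 'I_m.+1) (c : nat) : cvert :=
  if c is c'.+1 then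
    (if insub c' is Some i then inr (e, i) else inl e.2)
  else inl e.1.

Definition lend (a : label) := pt a.1 a.2.
Definition rend (a : label) := pt a.1 a.2.+1.
Definition step (a : label) : {perm cvert} := tperm (lend a) (rend a).
(** Permutations compose from left to right, so [wperm w x] is the final position of the token that
    starts at [x]. *)
Definition wperm (w : seq label) : {perm cvert} := (\prod_(a <- w) step a)%g.

Lemma wperm_cons a w : wperm (a :: w) = (step a * wperm w)%g.
Proof. by rewrite /wperm big_cons. Qed.

Lemma wperm_cat w1 w2 : wperm (w1 ++ w2) = (wperm w1 * wperm w2)%g.
Proof. by rewrite /wperm big_cat. Qed.

Lemma lend_rend a : (0 < l)%N -> lend a != rend a.
Proof.
case: a => e [[|c] lc] l_gt0; rewrite /lend /rend /=; first by rewrite insubT.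
rewrite insubT; case: insubP => [i _ vi|//].
by apply/eqP => -[] /(congr1 val) /=; rewrite vi; lia.
Qed.

(* The token is tracked by its current position [x]. *)
Fixpoint crossings (q : pred label) (x : cvert) (w : seq label) : nat :=
  if w is a :: w' then
    (q a && ((x == lend a) || (x == rend a))) + crossings q (step a x) w'
  else 0.

Lemma crossings_cat q x w1 w2 :
  crossings q x (w1 ++ w2) = crossings q x w1 + crossings q (wperm w1 x) w2.
Proof.
elim: w1 x => [|a w1 IH] x /=; first by rewrite /wperm big_nil perm1.
by rewrite IH addnA wperm_cons permM.
Qed.

Lemma crossings_le q x w : crossings q x w <= count q w.
Proof. by elim: w x => [|a w IH] x //=; rewrite leq_add //; case: (q a) => //=; case: (_ || _). Qed.

Lemma crossings_eq q1 q2 x w : q1 =1 q2 -> crossings q1 x w = crossings q2 x w.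
Proof. by move=> q12; elim: w x => [|a w IH] x //=; rewrite IH q12. Qed.

Lemma crossings_predU q1 q2 x w : (forall a, ~~ (q1 a && q2 a)) ->
  crossings (predU q1 q2) x w = crossings q1 x w + crossings q2 x w.
Proof.
move=> q12; elim: w x => [|a w IH] x //=; rewrite IH.
by have := q12 a; case: (q1 a) (q2 a) => -[] //= _; lia.
Qed.

Lemma crossings_sub q1 q2 x w : subpred q1 q2 ->
  crossings q1 x w <= crossings q2 x w.
Proof.
move=> q12; elim: w x => [|a w IH] x //=; rewrite leq_add //.
by have := q12 a; case: (q1 a) => [->|] //=.
Qed.

Lemma sum_crossings w : (0 < l)%N ->
  \sum_x crossings predT x w = 2 * size w.
Proof.
move=> l_gt0; elim: w => [|a w IH] /=; first by rewrite big1.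
rewrite big_split /=.
have -> : \sum_x crossings predT (step a x) w = \sum_x crossings predT x w.
  by rewrite [RHS](reindex_inj (@perm_inj _ (step a))).
rewrite IH.
suff -> : \sum_x ((x == lend a) || (x == rend a) : nat) = 2 by rewrite mulnS.
have -> : 2 = #|[set lend a; rend a]| by rewrite cards2 lend_rend.
by rewrite -sum1_card [RHS]big_mkcond; apply: eq_bigr => x _; rewrite !inE; case: (_ || _).
Qed.

(** Every move of the token along an edge at [v] toggles whether the token is on [v], because the
    two ends of an edge differ. *)
Lemma crossings_parity v x w : (0 < l)%N ->
  odd (crossings (fun a => (v == lend a) || (v == rend a)) x w)
    = (x == v) (+) (wperm w x == v).
Proof.
move=> l_gt0; elim: w x => [|a w IH] x /=.
  by rewrite /wperm big_nil perm1 addbb.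
rewrite oddD IH wperm_cons permM addbA; congr (_ (+) _).
have := lend_rend a l_gt0; rewrite /step.
move: (lend a) (rend a) => u u' neq.
case: tpermP => [->|->|/eqP/negPf-> /eqP/negPf->].
- by rewrite eqxx andbT !(eq_sym _ v);
  case: (v =P u) (v =P u') => [->|_] [e|_] //=; rewrite e eqxx in neq.
- by rewrite eqxx orbT andbT !(eq_sym _ v);
  case: (v =P u) (v =P u') => [->|_] [e|_] //=; rewrite e eqxx in neq.
- by rewrite andbF.
Qed.

Lemma pt_interior e c (lc : (c < l)%N) : pt e c.+1 = inr (e, Ordinal lc).
Proof. by rewrite /pt insubT. Qed.

Lemma touch_interior e c (lc : (c < l)%N) (a : label) :
  (pt e c.+1 == lend a) || (pt e c.+1 == rend a)
  = (a == (e, inord c)) || (a == (e, inord c.+1)).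
Proof.
rewrite pt_interior; case: a => e' [d ld]; rewrite /lend /rend /=.
have -> : ((e', Ordinal ld) == (e, inord c)) = (e' == e) && (d == c).
  by rewrite xpair_eqE -val_eqE /= inordK // ltnW.
have -> : ((e', Ordinal ld) == (e, inord c.+1)) = (e' == e) && (d == c.+1).
  by rewrite xpair_eqE -val_eqE /= inordK.
have E (k : nat) : ((inr (e, Ordinal lc) : cvert) == pt e' k.+1) = (e' == e) && (k == c).
  rewrite /pt; case: insubP => [i _ vi|/negP ge].
    apply/eqP/andP => [[-> /(congr1 val) /= ->]|[/eqP-> /eqP kc]]; first by rewrite vi.
    by congr (inr (_, _)); apply: val_inj; rewrite /= vi.
  by apply/esym/negP => /andP[_ /eqP kc]; apply: ge; rewrite kc.
rewrite E orbC; congr (_ || _).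
by case: d ld => [|d] ld; [rewrite /= andbF|rewrite E].
Qed.

(* A closed walk enters and leaves the interior vertices of a path equally
   often, so it uses all edges of the path with the same parity. *)
Lemma long_crossing e c x w : (0 < l)%N -> wperm w x = x ->
  odd (crossings (pred1 (e, c)) x w) -> (l < crossings predT x w)%N.
Proof.
move=> l_gt0 wx oddc.
pose f k := odd (crossings (pred1 (e, inord k)) x w).
have f_step k : (k < l)%N -> f k = f k.+1.
  move=> kl; have := crossings_parity (pt e k.+1) x w l_gt0.
  rewrite wx addbb (crossings_eq _ _ (touch_interior e kl)).
  rewrite (@crossings_predU (pred1 (e, inord k)) (pred1 (e, inord k.+1))).
    by rewrite oddD -/(f k) -/(f k.+1); case: (f k) (f k.+1) => [] [].
  move=> a /=; apply/negP => /andP[/eqP-> /eqP[/(congr1 val)]] /=.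
  by rewrite !inordK; lia.
have f0 k : (k <= l)%N -> f k = f 0.
  by elim: k => // k IH kl; rewrite -f_step // IH // ltnW.
have fl k : (k <= l)%N -> f k.
  move=> kl; rewrite f0 //; have := f0 c; rewrite -ltnS ltn_ord => /(_ isT) <-.
  by rewrite /f inord_val.
(* An odd number of crossings is at least one, so the first [k] edges of the path contribute at
   least [k] moves. *)
suff H k : (k <= l.+1)%N -> (k <= crossings (fun a => (a.1 == e) && (a.2 < k)%N) x w)%N.
  by apply: leq_trans (H _ (leqnn _)) _; apply: crossings_sub.
elim: k => // k IH kl.
rewrite (@crossings_eq _
  (predU (fun a : label => (a.1 == e) && (a.2 < k)%N) (pred1 ((e, inord k) : label))));
  last first.
  move=> [e' d] /=; rewrite ltnS leq_eqVlt orbC xpair_eqE andb_orr.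
  by rewrite -val_eqE /= inordK.
rewrite crossings_predU; last first.
  by move=> a; apply/negP => /= /andP[/andP[_ ak] /eqP ea]; move: ak; rewrite ea /= inordK // ltnn.
rewrite -addn1 leq_add //; first by apply: IH; apply: ltnW.
by have := fl k kl; rewrite /f; case: crossings.
Qed.

End SubdividedCompleteGraph.

(** * Number of edges of a connected graph *)

Section Connectivity.
Variables (T E : finType) (src tgt : E -> T) (F : {set E}) (x0 : T).
Hypothesis connected : forall U : {set T}, x0 \in U ->
  (forall e, e \in F -> (src e \in U) = (tgt e \in U)) -> U = [set: T].

(** Grow a set from [x0]: as long as it is not everything, some edge of [F] leaves it. Adding the
    other end of this edge puts one more edge of [F] inside the set. *)
Lemma card_connected : #|T| <= #|F|.+1.
Proof.
have T_gt0 : (0 < #|T|)%N by apply/card_gt0P; exists x0.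
suff H k : (k < #|T|)%N -> exists U : {set T},
    [/\ x0 \in U, #|U| = k.+1 &
        (k <= #|[set e in F | (src e \in U) && (tgt e \in U)]|)%N].
  have [U [_ _ UF]] := H #|T|.-1 ltac:(by rewrite ltn_predL).
  rewrite -(prednK T_gt0) ltnS (leq_trans UF) // subset_leq_card //.
  by apply/fintype.subsetP => e; rewrite inE => /andP[].
elim: k => [|k IH] kT; first by exists [set x0]; rewrite inE eqxx cards1.
have [U [x0U cU UF]] := IH (ltnW kT).
have [e eF eU] : exists2 e, e \in F & (src e \in U) != (tgt e \in U).
  apply/exists_inP; case: (boolP [exists e in F, _]) => // /exists_inPn H.
  have UT : U = [set: T].
    by apply: connected => // e /H /negPn /eqP.
  by move: kT; rewrite -cardsT -UT cU ltnn.
pose y := if src e \in U then tgt e else src e.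
have yU : y \notin U.
  by move: eU; rewrite /y; case E1: (src e \in U); case E2: (tgt e \in U); rewrite ?E1 ?E2.
exists (y |: U); rewrite inE x0U orbT cardsU1 yU cU; split=> //.
have sub : e |: [set e in F | (src e \in U) && (tgt e \in U)] \subset
    [set e in F | (src e \in y |: U) && (tgt e \in y |: U)].
  apply/fintype.subsetP => e'; rewrite !inE => /orP[/eqP->|/and3P[-> -> ->]]; last by rewrite !orbT.
  rewrite eF /y; move: eU; case E1: (src e \in U); case E2: (tgt e \in U) => //= _;
    by rewrite eqxx ?orbT.
apply: leq_trans (subset_leq_card sub); rewrite cardsU1 !inE.
by move: eU; case: (src e \in U); case: (tgt e \in U) => //= _; rewrite andbF.
Qed.
End Connectivity.

(** * Shortest words and swaps between busy tokens *)

Section LowerBound.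
Variables m l : nat.
Local Notation label := (label m l).
Local Notation cvert := (cvert m l).

Definition minimal_word (w : seq label) :=
  forall w', wperm w' = wperm w -> (size w <= size w')%N.

(* Deleting two swaps of the same pair of tokens only exchanges the roles of
   these tokens in between. *)
Lemma delete_repeated_swap (w1 w2 w3 : seq label) a b :
  (step a ^ (wperm w1)^-1 = step b ^ (wperm (w1 ++ a :: w2))^-1)%g ->
  wperm (w1 ++ w2 ++ w3) = wperm (w1 ++ a :: w2 ++ b :: w3).
Proof.
rewrite !(wperm_cat, wperm_cons) => E.
have {}E : (wperm w1 * step a * wperm w2 * step b = wperm w1 * wperm w2)%g.
  move: E; rewrite !conjgE !invgK => E.
  have -> : (wperm w1 * step a * wperm w2 * step b =
    (wperm w1 * (step a * wperm w2)) *
      (step b * (wperm w1 * (step a * wperm w2))^-1) * (wperm w1 * (step a * wperm w2)))%g.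
    by rewrite -!mulgA mulVg mulg1.
  by rewrite -E -!mulgA mulKg (mulgA (step a)) tperm2 mul1g.
by rewrite !mulgA -E.
Qed.

Section Word.
Variable w : seq label.
Let A (j : 'I_(size w)) := tnth (in_tuple w) j.

(** Conjugation by the prefix turns a transposition of positions into the transposition of the two
    tokens that are swapped, each named by its initial position. *)
Definition token_swap (j : 'I_(size w)) : {perm cvert} :=
  (step (tnth (in_tuple w) j) ^ (wperm (take j w))^-1)%g.

Lemma split_at (j : 'I_(size w)) : w = take j w ++ A j :: drop j.+1 w.
Proof. by rewrite /A (tnth_nth (A j)) -drop_nth // cat_take_drop. Qed.

Lemma token_swap_inj : minimal_word w -> injective token_swap.
Proof.
move=> wmin; suff H (i j : 'I_(size w)) : (i < j)%N -> token_swap i <> token_swap j.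
  move=> i j ij; apply/val_inj/eqP; case: ltngtP => // [/H|/H] //.
  by move=> K; case: K.
move=> ij; rewrite /token_swap => E.
pose w2 := take (j - i.+1) (drop i.+1 w).
have Etake : take j w = take i w ++ A i :: w2.
  rewrite (congr1 (take j) (split_at i)) take_cat size_takel ?(ltnW (ltn_ord i)) //.
  rewrite ltnNge (ltnW ij) /=.
  by rewrite -[(j - i)%N]prednK ?subn_gt0 //= /w2 subnS.
have Ew : w = take i w ++ A i :: w2 ++ A j :: drop j.+1 w.
  by apply: etrans (split_at j) _; rewrite Etake -catA.
rewrite Etake in E.
have /wmin := etrans (@delete_repeated_swap _ _ (drop j.+1 w) _ _ E)
  (esym (congr1 (@wperm m l) Ew)).
have := congr1 size Ew; rewrite !size_cat /= size_cat /=.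
move: (size _) (size (take _ _)) (size w2) (size (drop _ _)); lia.
Qed.

Lemma token_swapE j : token_swap j =
  tperm (((wperm (take j w))^-1)%g (lend (A j))) (((wperm (take j w))^-1)%g (rend (A j))).
Proof. by rewrite /token_swap tpermJ. Qed.

Definition swaps_inside (B : {set cvert}) : {set 'I_(size w)} :=
  [set j : 'I_(size w) | (((wperm (take j w))^-1)%g (lend (A j)) \in B) &&
     (((wperm (take j w))^-1)%g (rend (A j)) \in B)].

(** In a minimal word different times swap different pairs of tokens, and here both tokens come from
    [B]. *)
Lemma card_swaps_inside B : minimal_word w -> (#|swaps_inside B| <= #|B| ^ 2)%N.
Proof.
move=> wmin; rewrite -(card_imset _ (token_swap_inj wmin)) -mulnn -cardsX.
apply: leq_trans (leq_imset_card (fun x => tperm x.1 x.2) _).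
apply/subset_leq_card/fintype.subsetP => _ /imsetP[j jB ->]; rewrite token_swapE.
pose q := (wperm (take j w))^-1%g.
by apply/imsetP; exists (q (lend (A j)), q (rend (A j))) => //; move: jB; rewrite !inE.
Qed.

Hypothesis l_gt0 : (0 < l)%N.

Definition busy : {set cvert} :=
  [set t | wperm w t != t] :|: [set t | (l < crossings predT t w)%N].

(** Both tokens swapped at time [j] cross this edge exactly once. Such a token either ends away from
    home or, by [long_crossing], makes more than [l] moves. *)
Lemma single_crossing_inside (j : 'I_(size w)) :
  count (pred1 (A j)) w = 1 -> j \in swaps_inside busy.
Proof.
move=> c1.
have cnt1 t : (wperm (take j w) t == lend (A j)) || (wperm (take j w) t == rend (A j)) ->
    crossings (pred1 (A j)) t w = 1.
  move=> tj; apply/eqP; rewrite eqn_leq -{1}c1 crossings_le /=.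
  by rewrite (congr1 (crossings _ _) (split_at j)) crossings_cat /= eqxx tj addnCA.
have in_busy t : (wperm (take j w) t == lend (A j)) || (wperm (take j w) t == rend (A j)) ->
    t \in busy.
  move=> /cnt1 ct; rewrite !inE; case: eqP => //= tt.
  apply: (long_crossing (e := (A j).1) (c := (A j).2)) => //.
  by rewrite -surjective_pairing ct.
by rewrite inE !in_busy // permKV eqxx ?orbT.
Qed.

End Word.
End LowerBound.

(** * Lower bound for rotating the branch vertices *)

Section LowerBoundFinal.
Variables m l : nat.

Local Notation label := (label m l).
Local Notation cvert := (cvert m l).

Definition is_rotation (g : {perm cvert}) :=
  (forall i, g (inl i) = inl (ordS i)) /\ (forall p, g (inr p) = inr p).

Lemma ordS_closed (U : {set 'I_m.+1}) i0 : i0 \in U ->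
  (forall i, (ordS i \in U) = (i \in U)) -> U = [set: 'I_m.+1].
Proof.
move=> i0U closed.
have H (k : nat) : (k < m.+1)%N -> (inord k \in U) = (ord0 \in U).
  elim: k => [|k IH] km; first by congr (_ \in U); apply/val_inj; rewrite /= inordK.
  rewrite -IH ?(ltnW km) // -[RHS]closed; congr (_ \in U); apply/val_inj.
  by rewrite /= !inordK ?(ltnW km) // modn_small.
have U0 : ord0 \in U by rewrite -(H i0) ?inord_val.
by apply/setP => i; rewrite inE -[i]inord_val H.
Qed.

(* The component of [x] after removal of the [c]-th edge of every path. *)
Definition cell (c : nat) (x : cvert) : 'I_m.+1 :=
  match x with
  | inl i => i
  | inr (e, i) => if (i < c)%N then e.1 else e.2
  end.

Lemma cell_pt c e k : (c <= l)%N ->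
  cell c (pt l e k) = if (k <= c)%N || (k == 0) then e.1 else e.2.
Proof.
case: k => [|k] //= cl.
rewrite orbF; case: insubP => [i _ <-|kl] //=.
by rewrite ifN //; lia.
Qed.

(** An edge that is not the [c]-th of its path has both ends in the same cell. *)
Lemma cell_step c (a : label) (U : {set 'I_m.+1}) x :
  (c <= l)%N -> (a.2 = c :> nat -> (a.1.1 \in U) = (a.1.2 \in U)) ->
  (cell c (step a x) \in U) = (cell c x \in U).
Proof.
move=> cl aU; rewrite /step.
have E : (cell c (lend a) \in U) = (cell c (rend a) \in U).
  rewrite /lend /rend !cell_pt //.
  rewrite orbF; case: (ltngtP a.2 c) aU => //= ac aU; last exact: aU.
  by rewrite ifN //; lia.
by case: tpermP => [->|->|].
Qed.

(** Let [F] be the set of paths whose [c]-th edge is used. If no path in [F] leaves [U], then no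
    token changes between cells in [U] and cells outside; the rotation then forces [U] to be closed
    under [ordS]. So [F] connects the branch vertices, and each of its at least [m] paths is used
    twice. *)
Lemma swaps_per_level (w : seq label) (c : 'I_l.+1) :
  is_rotation (wperm w) ->
  (forall e, count (pred1 (e, c)) w != 1) ->
  (2 * m <= count (fun a => a.2 == c) w)%N.
Proof.
move=> [rot _] no1.
pose F := [set e | (0 < count (pred1 (e, c)) w)%N].
have mF : (m.+1 <= #|F|.+1)%N.
  rewrite -{1}[m.+1]card_ord; apply: (@card_connected _ _ fst snd F ord0) => U U0 UF.
  apply: (ordS_closed U0) => i.
  have -> : ordS i = cell c (wperm w (inl i)) by rewrite rot.
  have H : all (fun a : label => (a.2 == c) ==> ((a.1.1 \in U) == (a.1.2 \in U))) w.
    apply/allP => a aw; apply/implyP => /eqP ac; apply/eqP/UF.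
    by rewrite inE -has_count; apply/hasP; exists a => //=; rewrite -ac -surjective_pairing.
  rewrite -[in RHS]/(cell c (inl i)); move: (inl i : cvert) => x {rot no1 UF F}.
  elim: w H x => [|a w' IH] /=; first by move=> _ x; rewrite /wperm big_nil perm1.
  case/andP => Ha Hw x; rewrite wperm_cons permM IH //; apply: cell_step => [|ac].
    by rewrite -ltnS.
  by apply/eqP; apply: (implyP Ha); apply/eqP/val_inj.
have -> : count (fun a => a.2 == c) w = \sum_e count (pred1 (e, c)) w.
  elim: (w) => [|a w' IH] /=; first by rewrite big1.
  rewrite big_split /= -IH; congr (_ + _).
  have aE e : (a == (e, c)) = (a.1 == e) && (a.2 == c) by case: (a).
  rewrite (bigD1 a.1) //= big1 => [|e ea]; first by rewrite addn0 aE eqxx.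
  by rewrite aE eq_sym (negPf ea).
rewrite (bigID (mem F)) /=; apply: leq_trans (leq_addr _ _).
apply: leq_trans (_ : 2 * #|F| <= _)%N; first by rewrite leq_mul2l.
rewrite mulnC -sum_nat_const; apply: leq_sum => e.
by rewrite inE; move: (no1 e); case: count => [|[]].
Qed.

Hypothesis l_gt0 : (0 < l)%N.

(** At most [m.+1] tokens end away from home. Each swap moves two tokens, so there are at most
    [4 * m.+1 * l.+1] moves, and at most [4 * m.+1] tokens can make [l.+1] of them. *)
Lemma card_busy (w : seq label) : is_rotation (wperm w) ->
  (size w <= 2 * m.+1 * l.+1)%N -> (#|busy w| <= 5 * m.+1)%N.
Proof.
move=> [_ fixI] sw; apply: leq_trans (leq_card_setU _ _) _.
rewrite (_ : 5 * m.+1 = m.+1 + 4 * m.+1)%N; last by lia.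
apply: leq_add.
  rewrite -[X in (_ <= X)%N]card_ord
    -(card_codom (@inl_inj 'I_m.+1 ('I_m.+1 * 'I_m.+1 * 'I_l))) -[X in (_ <= X)%N]cardsE.
  apply/subset_leq_card/fintype.subsetP => -[i|p]; rewrite !inE ?fixI ?eqxx // => _.
  exact: codom_f.
rewrite -(leq_pmul2r (ltn0Sn l)) -sum_nat_const.
apply: leq_trans (_ : \sum_x crossings predT x w <= _)%N; last by rewrite sum_crossings; lia.
rewrite [X in (_ <= X)%N](bigID [pred x | x \in [set t | (l < crossings predT t w)%N]]) /=.
by apply: leq_trans (leq_addr _ _); apply: leq_sum => x; rewrite inE.
Qed.

Theorem rotation_lower_bound (w : seq label) : is_rotation (wperm w) ->
  (2 * m * (l.+1 - 25 * m.+1 ^ 2) <= size w)%N.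
Proof.
move=> rot.
wlog wmin : w rot / minimal_word w => [H|].
  pose Q n := [exists s : n.-tuple label, wperm s == wperm w].
  have exQ : exists n, Q n by exists (size w); apply/existsP; exists (in_tuple w).
  case: (ex_minnP exQ) => n /existsP[s /eqP sw] nmin.
  have Qs s' : wperm s' = wperm w -> Q (size s').
    by move=> E; apply/existsP; exists (in_tuple s'); apply/eqP.
  apply: leq_trans (H s _ _) _; first by rewrite sw.
    by move=> s' E; rewrite size_tuple; apply/nmin/Qs; rewrite E.
  by rewrite size_tuple; apply/nmin/Qs.
(* A longer word satisfies the bound at once; for the others [card_busy] applies. *)
have [sw|/ltnW sw] := leqP (size w) (2 * m.+1 * l.+1); last first.
  apply: leq_trans sw; rewrite leq_mul //; first by lia.
  exact: leq_subr.
(* The bad levels are those at which two busy tokens are swapped. Every other level costs [2 * m]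
   swaps, since an edge used only once would make its level bad. *)
pose bad := [set (tnth (in_tuple w) j).2 | j in swaps_inside w (busy w)].
have card_bad : (#|bad| <= 25 * m.+1 ^ 2)%N.
  apply: leq_trans (leq_imset_card _ _) _.
  apply: leq_trans (card_swaps_inside (busy w) wmin) _.
  by rewrite (_ : 25 = 5 ^ 2) // -expnMn leq_exp2r // card_busy.
have -> : size w = \sum_(c < l.+1) count (fun a : label => a.2 == c) w.
  elim: (w) => [|a w' IH] /=; first by rewrite big1.
  rewrite big_split /= -IH (bigD1 a.2) //= eqxx big1 ?addn0 // => c.
  by rewrite eq_sym => /negPf->.
rewrite (bigID (mem (~: bad))) /=; apply: leq_trans (leq_addr _ _).
apply: leq_trans (_ : \sum_(c in ~: bad) 2 * m <= _)%N.
  rewrite sum_nat_const mulnC leq_mul2r; apply/orP; right.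
  have := cardsC bad; rewrite card_ord; move: card_bad.
  by move: #|bad| #|~: bad| (25 * _) => x y z; lia.
apply: leq_sum => c cgood; apply: swaps_per_level => // e; apply/negP => /eqP c1.
have : has (pred1 (e, c)) w by rewrite has_count c1.
move/hasP => [a aw /eqP ae].
have [j Ej] : exists j : 'I_(size w), tnth (in_tuple w) j = (e, c).
  have /(nthP a) [j js jE] : (e, c) \in w by rewrite -ae.
  by exists (Ordinal js); rewrite (tnth_nth a).
move: cgood; rewrite inE => /negP; apply.
apply/imsetP; exists j; last by rewrite Ej.
by apply: single_crossing_inside => //; rewrite Ej.
Qed.

End LowerBoundFinal.

(** * Distances and unit weights *)

Section Distance.
Variables (R : realType) (I : instance R).
Implicit Types x y z : vertex I.

Lemma gdist_path x p : path (adj I) x p -> (gdist x (last x p) <= size p)%N.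
Proof.
move=> xp; rewrite /gdist; case: ex_minnP => k _; apply.
by apply/existsP; exists (in_tuple p); rewrite xp eqxx.
Qed.

Lemma gdist_walk x y : exists p, [/\ path (adj I) x p, last x p = y & size p = gdist x y].
Proof.
rewrite /gdist; case: ex_minnP => k /existsP[p /andP[xp /eqP py]] _.
by exists p; rewrite size_tuple.
Qed.

Lemma gdist_refl x : gdist x x = 0.
Proof. by apply/eqP; rewrite -leqn0; apply: (@gdist_path x [::]). Qed.

Lemma gdist_triangle x y z : (gdist x z <= gdist x y + gdist y z)%N.
Proof.
have [p [xp py <-]] := gdist_walk x y; have [q [yq qz <-]] := gdist_walk y z.
have -> : z = last x (p ++ q) by rewrite last_cat py.
by rewrite -size_cat gdist_path // cat_path xp py.
Qed.

Lemma gdist_adj x y z : adj I x y -> (gdist x z <= (gdist y z).+1)%N.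
Proof.
move=> xy; apply: leq_trans (gdist_triangle x y z) _.
by rewrite -add1n leq_add2r; apply: (@gdist_path x [:: y]); rewrite /= xy.
Qed.

(** Along a shortest walk [f] drops by at most one per edge. Thus 1-Lipschitz functions bound
    distances from below. *)
Lemma le_gdist (f : vertex I -> nat) x y :
  (forall u v, adj I u v -> f u <= (f v).+1)%N -> (f x <= f y + gdist x y)%N.
Proof.
move=> lip; have [p [xp <- <-]] := gdist_walk x y.
elim: p x xp => [|z p IH] x /=; first by rewrite addn0.
by case/andP => /lip xz /IH zp; lia.
Qed.

End Distance.

Section UnitWeights.
Variables (R : realType) (I : instance R).
Hypothesis weight1 : forall t : token I, weight I t = 1%R.

Lemma run_cost_unit (p : position I) s : bijective p ->
  (forall e, e \in s -> adj I e.1 e.2) -> run_cost p s = (2 * size s)%:R%R.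
Proof.
elim: s p => [|e s IH] p pb sadj /=; first by rewrite muln0.
rewrite IH; last 2 first.
- by apply: bij_comp pb; exact: injF_bij (@perm_inj _ _).
- by move=> e' e's; apply: sadj; rewrite inE e's orbT.
rewrite mulnS natrD; congr (_ + _)%R; rewrite /swap_cost.
under eq_bigr do rewrite weight1.
have [f fK Kf] := pb.
have e12 : f e.1 != f e.2.
  apply/eqP => /(congr1 p); rewrite !Kf => e12.
  by have := sadj e (mem_head _ _); rewrite e12 adj_irr.
have c2 : #|[set f e.1; f e.2]| = 2 by rewrite cards2 e12.
rewrite sumr_const -[in RHS]c2; congr (_ *+ _)%R.
by apply: eq_card => t; rewrite !inE /participates -2!(can2_eq fK Kf).
Qed.

Lemma cost_unit (s : seq (vertex I * vertex I)) : valid_solution s -> cost s = (2 * size s)%:R%R.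
Proof. by case=> sadj _; apply: run_cost_unit sadj; exact: start_bij. Qed.

Lemma max_weight_unit : max_weight I = 1%R.
Proof.
rewrite /max_weight; under eq_bigr do rewrite weight1.
have [f _ _] := start_bij I; have /card_gt0P[x _] := vertex_gt0 I.
rewrite (bigD1 (f x)) //=; apply/max_idPl.
by elim/big_ind: _ => [|a b a1 b1|//]; rewrite ?ler01 // ge_max a1.
Qed.

Lemma min_weight_unit : min_weight I = 1%R.
Proof.
rewrite /min_weight max_weight_unit; under eq_bigr do rewrite weight1.
by elim/big_ind: _ => // a b -> ->; rewrite minxx.
Qed.

End UnitWeights.

(** * The instance *)

Section Instance.
Variables (R : realType) (m h n : nat).

Local Notation l := (h.*2.+1).
Local Notation r := (h.+2).
Local Notation cvert := (cvert m l).
Local Notation label := (label m l).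

(** The copies come in [n.+1] blocks of [r], the number of vertices of a leg, so that the branch
    tokens of one block fill the legs exactly. *)
Definition copy : finType := ('I_n.+1 * 'I_r)%type.
Definition vert : finType := (copy * cvert + 'I_m.+1 * 'I_r)%type.

Definition joins (k : label) (u v : cvert) :=
  ((u == lend k) && (v == rend k)) || ((v == lend k) && (u == rend k)).

Definition vadj (x y : vert) : bool :=
  match x, y with
  | inl (a, u), inl (b, v) => (a == b) && [exists k, joins k u v]
  | inl (a, u), inr (i, s) | inr (i, s), inl (a, u) => (u == inl i) && (s == ord0)
  | inr (i, s), inr (j, t) =>
      if i == j then (s.+1 == t) || (t.+1 == s)
      else (s == ord_max) && (t == ord_max)
  end.

Lemma joinsC k u v : joins k u v = joins k v u.
Proof. by rewrite /joins orbC. Qed.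

Lemma vadj_sym : symmetric vadj.
Proof.
move=> [[a u]|[i s]] [[b v]|[j t]] //=.
  by rewrite eq_sym; under eq_existsb do rewrite joinsC.
by rewrite eq_sym orbC andbC.
Qed.

Lemma vadj_irr : irreflexive vadj.
Proof.
move=> [[a u]|[i s]] /=; last by rewrite eqxx orbb; apply/negP => /eqP; lia.
rewrite eqxx andTb; apply/existsP => -[k]; rewrite /joins orbb => /andP[/eqP uk /eqP].
by rewrite uk => /eqP; rewrite (negPf (lend_rend _ _)).
Qed.

Lemma joins_pt e c : (c <= l)%N -> [exists k, joins k (pt l e c.+1) (pt l e c)].
Proof.
move=> cl; apply/existsP; exists (e, inord c).
by rewrite /joins /lend /rend /= !inordK // !eqxx orbT.
Qed.

Lemma pt_last (e : 'I_m.+1 * 'I_m.+1) : pt l e l.+1 = inl e.2.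
Proof. by rewrite /pt insubN // ltnn. Qed.

Lemma vadj_conn x y : connect vadj x y.
Proof.
have csym : connect_sym vadj by apply: sym_connect_sym; exact: vadj_sym.
suff H z : connect vadj z (inr (ord0, ord_max)).
  by apply: connect_trans (H x) _; rewrite csym.
have Htop i : connect vadj (inr (i, ord_max)) (inr (ord0, ord_max)).
  case: (i =P ord0) => [->//|/eqP i0].
  by apply: connect1; rewrite /= (negPf i0) !eqxx.
have Hleg i k : (k < r)%N -> connect vadj (inr (i, inord k)) (inr (i, ord0)).
  elim: k => [|k IH] kr.
    by rewrite (_ : inord 0 = ord0) //; apply/val_inj; rewrite /= inordK.
  apply: connect_trans (IH (ltnW kr)); apply: connect1.
  by rewrite /= eqxx !inordK ?eqxx ?orbT // ltnW.
have HQ i s : connect vadj (inr (i, s)) (inr (ord0, ord_max)).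
  rewrite -[s]inord_val; apply: connect_trans (Hleg i s (ltn_ord s)) _.
  rewrite csym; apply: connect_trans (_ : connect _ _ (inr (i, ord_max))) _.
    by rewrite csym.
  rewrite -[ord_max]inord_val; exact: Hleg.
have HX a i : connect vadj (inl (a, inl i)) (inr (ord0, ord_max)).
  by apply: connect_trans (HQ i ord0); apply: connect1; rewrite /= !eqxx.
have Hpt a e c : (c <= l)%N -> connect vadj (inl (a, pt l e c)) (inr (ord0, ord_max)).
  elim: c => [|c IH] cl; first exact: HX.
  by apply: connect_trans (IH (ltnW cl)); apply: connect1; rewrite /= eqxx joins_pt // ltnW.
case: z => [[a [i|[e c]]]|[i s]] //.
have := Hpt a e c.+1 (ltn_ord c).
by rewrite (pt_interior _ (ltn_ord c)) (_ : Ordinal _ = c) //; apply/val_inj.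
Qed.

Definition target_fun (x : vert) : vert :=
  if x is inl (a, inl i) then inl (a, inl (ordS i)) else x.

Lemma target_fun_inj : injective target_fun.
Proof.
apply: (can_inj (g := fun x => if x is inl (a, inl i) then inl (a, inl (ord_pred i)) else x)).
by move=> [[a [i|p]]|q] //=; rewrite ordSK.
Qed.

Definition target : {perm vert} := perm target_fun_inj.

Lemma vert_gt0 : (0 < #|vert|)%N.
Proof. by apply/card_gt0P; exists (inr (ord0, ord0)). Qed.

Definition swap_instance : instance R :=
  @Instance R vert vadj vadj_sym vadj_irr vadj_conn vert_gt0
    vert (fun=> 1%R) (fun=> ltr01)
    id (inv_bij (fun=> erefl)) target (injF_bij (@perm_inj _ target)).

Local Notation I := swap_instance.

Lemma gdist_path_end a (e : 'I_m.+1 * 'I_m.+1) :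
  (@gdist R I (inl (a, inl e.2)) (inl (a, inl e.1)) <= l.+1)%N.
Proof.
rewrite -pt_last; elim: {-2}(l.+1) (leqnn l.+1) => [|c IH] cl; first by rewrite gdist_refl.
apply: leq_trans (@gdist_adj R I _ (inl (a, pt l e c)) _ _) _.
  by rewrite /= eqxx joins_pt.
by rewrite ltnS IH // ltnW.
Qed.

(* No geodesic between vertices of a copy uses the legs: [f] below is
   1-Lipschitz, vanishes at [z], and moves along the leg [j] from
   [D (inl j)] to the value [mu + h.+1], common to all legs. *)
Lemma gdist_leg a i z :
  (@gdist R I (inl (a, inl i)) (inl (a, z)) <= @gdist R I (inr (i, ord0)) (inl (a, z)))%N.
Proof.
pose D u := @gdist R I (inl (a, u)) (inl (a, z)).
have [j0 j0min] : exists j0, forall j, (D (inl j0) <= D (inl j))%N.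
  case: (arg_minnP (fun j => D (inl j)) (erefl : xpredT (ord0 : 'I_m.+1))) => j0 _ jmin.
  by exists j0 => j; apply: jmin.
pose mu := D (inl j0).
(* As [l.+1] is twice [h.+1], every [D (inl j)] is at distance at most [h.+1] from [mu + h.+1], so
   the [h.+1] edges of a leg suffice to reach that value. *)
have Dle j : (D (inl j) <= mu + l.+1)%N.
  apply: leq_trans (gdist_triangle _ (inl (a, inl j0) : vertex I) _) _.
  by rewrite addnC leq_add2l (gdist_path_end a (j0, j)).
pose f (x : vertex I) : nat := match x with
  | inl (_, u) => D u
  | inr (j, s) => maxn (D (inl j) - s) (minn (D (inl j) + s) (mu + h.+1))
  end.
have f0 j : f (inr (j, ord0)) = D (inl j) by rewrite /f /=; lia.
have fz : f (inl (a, z)) = 0 by rewrite /f /D gdist_refl.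
rewrite -[X in (X <= _)%N](f0 i) -[X in (_ <= X)%N]add0n -fz.
apply: le_gdist => -[[b u]|[j s]] [[b' v]|[j' s']].
- move=> /= /andP[_ uv]; apply: (@gdist_adj R I (inl (a, u)) (inl (a, v))).
  by rewrite /= eqxx.
- by move=> /andP[/eqP-> /eqP->]; rewrite f0.
- by move=> /andP[/eqP-> /eqP->]; rewrite f0.
- have := (j0min j, j0min j', Dle j, Dle j'); rewrite -/mu => -[[[]]].
  rewrite /vadj /f /=; case: (j =P j') => [<-|_] h1 h2 h3 h4.
    by case/orP => /eqP; lia.
  by case/andP => /eqP-> /eqP->; rewrite /=; lia.
Qed.

End Instance.

(** * Locally optimal runs stay inside the copies *)

Section Confinement.
Variables (R : realType) (m h n : nat).

Local Notation l := (h.*2.+1).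
Local Notation cvert := (cvert m l).
Local Notation label := (label m l).
Local Notation copy := (copy h n).
Local Notation vert := (vert m h n).
Local Notation I := (swap_instance R m h n).

Definition inside_copy (e : vert * vert) : bool :=
  match e with
  | (inl (a, u), inl (b, v)) => (a == b) && [exists k, joins k u v]
  | _ => false
  end.

Definition region (x : vert) : option copy :=
  if x is inl (a, _) then Some a else None.

Definition confined (p : vert -> vert) :=
  [/\ injective p, forall t, region (p t) = region t & forall q, p (inr q) = inr q].

(** A token on a leg is at home and cannot get closer to it. A token of a copy that enters a leg
    gets no closer to its start or destination by [gdist_leg], both lying in its own copy. *)
Lemma local_swap_inside (p : position I) (e : vertex I * vertex I) : confined p ->
  adj I e.1 e.2 -> gen_locally_optimal_swap p e -> inside_copy e.
Proof.
move=> [pinj preg pQ] ee [t [pt opt]].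
have home q : p t <> inr q.
  move=> ptq; have tq : t = inr q by apply: pinj; rewrite pQ.
  by move: opt; rewrite ptq tq /= /target permE /= gdist_refl; case.
have leg a i : p t = inl (a, inl i) -> do_swap p e t = inr (i, ord0) ->
    forall z, region z = Some a ->
    ~ (@gdist R I (do_swap p e t) z < @gdist R I (p t) z)%N.
  move=> -> -> [[b z]|//] [->]; apply/negP; rewrite -leqNgt; exact: gdist_leg.
have done a i : p t = inl (a, inl i) -> do_swap p e t = inr (i, ord0) -> False.
  move=> pta pte; have ta : region t = Some a by rewrite -preg pta.
  case: opt; last exact: (leg a i pta pte t ta).
  apply: (leg a i pta pte (dest I t)).
  by rewrite /= /target permE; case: (t) ta => [[b [j|q]]|q].
move: ee pt; case: (e) home done {opt leg} => x y.
rewrite /do_swap /participates /=; case: x y => [[a u]|[i s]] [[b v]|[j s']] //= home done.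
- move=> /andP[/eqP ui /eqP s0] /orP[/eqP pt|/eqP pt]; last by case: (home _ pt).
  by case: (done a j); rewrite ?pt ?tpermL ?ui ?s0.
- move=> /andP[/eqP ui /eqP s0] /orP[/eqP pt|/eqP pt]; first by case: (home _ pt).
  by case: (done b i); rewrite ?pt ?tpermR ?ui ?s0.
- by move=> _ /orP[/eqP/home|/eqP/home].
Qed.

Lemma do_swap_confined (p : position I) (e : vertex I * vertex I) : confined p -> inside_copy e ->
  confined (do_swap p e).
Proof.
move=> [pinj preg pQ]; case: e => -[[a u]|q] [[b v]|q'] //= /andP[/eqP<- _].
split=> [t t' /perm_inj/pinj//|t|q]; rewrite /do_swap /=.
  by rewrite -[RHS]preg; case: tpermP => [->|->|].
by rewrite pQ tpermD.
Qed.

Lemma local_run_inside (p : position I) (s : seq (vertex I * vertex I)) : confined p ->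
  (forall e, e \in s -> adj I e.1 e.2) -> gen_locally_optimal_from p s ->
  forall e, e \in s -> inside_copy e.
Proof.
elim: s p => [|e s IH] p pc sadj //= [opte opts] e'.
have e_in : inside_copy e.
  by apply: local_swap_inside pc _ opte; apply: sadj; rewrite mem_head.
rewrite inE => /orP[/eqP->//|].
apply: IH opts _; first exact: do_swap_confined.
by move=> e'' e''s; apply: sadj; rewrite inE e''s orbT.
Qed.

Definition trace (a : copy) (w : seq (copy * label)) : seq label :=
  [seq k.2 | k <- w & k.1 == a].

Lemma sum_size_trace w : \sum_a size (trace a w) = size w.
Proof.
elim: w => [|[a k] w IH] /=; first by rewrite big1.
rewrite -IH (bigD1 a) //= [in RHS](bigD1 a) //= {1}/trace /= eqxx /= addSn.
by congr (_ + _).+1; apply: eq_bigr => b ba; rewrite /trace /= eq_sym (negPf ba).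
Qed.

(** Copies are disjoint, so the tokens of copy [a] only notice the swaps of [trace a w]. *)
Lemma run_traces (s : seq (vertex I * vertex I)) : (forall e, e \in s -> inside_copy e) ->
  exists w, size w = size s /\
    forall (p : position I) t a x, p t = inl (a, x) -> run p s t = inl (a, wperm (trace a w) x).
Proof.
elim: s => [|e s IH] s_in.
  by exists [::]; split=> // p t a x pt; rewrite /wperm big_nil perm1.
have [w [sw wP]] := IH (fun e' e's => s_in e' (mem_behead (s := e :: s) e's)).
have := s_in e (mem_head _ _).
case: e {s_in} => -[[b u]|q] [[b' v]|q'] //= /andP[/eqP<- /existsP[k kuv]].
have Ek : tperm u v = step k.
  by move: kuv; rewrite /joins /step =>
    /orP[/andP[/eqP-> /eqP->]|/andP[/eqP-> /eqP->]] //; exact: tpermC.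
exists ((b, k) :: w); split=> [|p t a x pt]; first by rewrite /= sw.
have injb : injective (fun x : cvert => inl (b, x) : vert) by move=> y y' [].
rewrite /trace /=; case: (b =P a) => [ba|ba] /=.
  subst b; rewrite wperm_cons permM; apply: wP.
  by rewrite /do_swap pt /= -Ek (inj_tperm _ _ _ injb).
by apply: wP; rewrite /do_swap pt /= tpermD //; apply/eqP => -[/ba].
Qed.

Theorem local_size_ge (s : seq (vertex I * vertex I)) : gen_locally_optimal s -> valid_solution s ->
  (#|copy| * (2 * m * (l.+1 - 25 * m.+1 ^ 2)) <= size s)%N.
Proof.
move=> opt [sadj sdest].
have start_confined : confined (start I) by split.
have [w [<- wP]] := run_traces (local_run_inside start_confined sadj opt).
rewrite -sum_size_trace -sum_nat_const; apply: leq_sum => a _.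
apply: rotation_lower_bound => //; split=> [i|q].
- have := wP (start I) (inl (a, inl i)) a (inl i) erefl.
  by rewrite sdest /= /target permE => -[].
- have := wP (start I) (inl (a, inr q)) a (inr q) erefl.
  by rewrite sdest /= /target permE => -[].
Qed.

End Confinement.

(** * Words of edge swaps *)

Section PermProducts.
Variable V : finType.
Implicit Types (x y : V) (c : {perm V}).

Lemma prod_perm_fix (J : eqType) (s : seq J) (g : J -> {perm V}) x :
  (forall j, j \in s -> g j x = x) -> (\prod_(j <- s) g j)%g x = x.
Proof.
elim: s => [|j s IH] gx; first by rewrite big_nil perm1.
rewrite big_cons permM gx ?mem_head // IH // => k ks.
by apply: gx; rewrite inE ks orbT.
Qed.

Lemma prod_perm_single (J : eqType) (s : seq J) (g : J -> {perm V}) k x y :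
  uniq s -> k \in s -> g k x = y ->
  (forall j, j \in s -> j != k -> g j x = x /\ g j y = y) ->
  (\prod_(j <- s) g j)%g x = y.
Proof.
move=> us ks gxy gfix; elim: s us ks gfix => // j s IH /= /andP[js us] ks gfix.
rewrite big_cons permM; have [jk|jk] := eqVneq j k.
  rewrite jk gxy; apply: prod_perm_fix => j' j's.
  have jj' : j' != k by apply: contraNneq js; rewrite jk => <-.
  by have [] := gfix j' (mem_behead (s := j :: s) j's) jj'.
have [-> _] := gfix j (mem_head _ _) jk.
apply: IH => //; first by move: ks; rewrite inE eq_sym (negPf jk).
by move=> j' j's; apply: gfix; rewrite inE j's orbT.
Qed.

Lemma conjg_prod (J : Type) (s : seq J) (g : J -> {perm V}) c :
  ((\prod_(j <- s) g j) ^ c = \prod_(j <- s) (g j ^ c))%g.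
Proof. elim: s => [|j s IH]; first by rewrite !big_nil conj1g.
by rewrite !big_cons conjMg IH. Qed.

Lemma prod_tperm_image (J : finType) (ts : seq (J * J)) (f : J -> V) j : injective f ->
  (\prod_(t <- ts) tperm (f t.1) (f t.2))%g (f j) = f ((\prod_(t <- ts) tperm t.1 t.2)%g j).
Proof.
move=> finj; elim: ts j => [|t ts IH] j; first by rewrite !big_nil !perm1.
by rewrite !big_cons !permM -IH (inj_tperm _ _ _ finj).
Qed.

End PermProducts.

Section WordLength.
Variables (V : finType) (e : rel V).

Definition word_le (k : nat) (g : {perm V}) : Prop :=
  exists s : seq (V * V), [/\ (size s <= k)%N, forall a, a \in s -> e a.1 a.2 &
    (\prod_(a <- s) tperm a.1 a.2)%g = g].

Lemma word_le1 k : word_le k 1%g.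
Proof. by exists [::]; rewrite big_nil. Qed.

Lemma word_leM k1 k2 g1 g2 : word_le k1 g1 -> word_le k2 g2 -> word_le (k1 + k2) (g1 * g2)%g.
Proof.
move=> [s1 [k1P a1 <-]] [s2 [k2P a2 <-]]; exists (s1 ++ s2).
rewrite size_cat leq_add // big_cat; split=> // a.
by rewrite mem_cat => /orP[/a1|/a2].
Qed.

Lemma word_leV k g : word_le k g -> word_le k g^-1%g.
Proof.
move=> [s [ks sP <-]]; exists (rev s); rewrite size_rev; split=> // [a|].
  by rewrite mem_rev => /sP.
elim: s {ks sP} => [|a s IH]; first by rewrite !big_nil invg1.
by rewrite rev_cons -cats1 big_cat big_seq1 big_cons invMg tpermV IH.
Qed.

Lemma word_le_trans k1 k2 g : word_le k1 g -> (k1 <= k2)%N -> word_le k2 g.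
Proof. by move=> [s [ks sP gE]] k12; exists s; split=> //; apply: leq_trans ks k12. Qed.

Lemma word_le_tperm x y : e x y -> word_le 1 (tperm x y).
Proof. by move=> xy; exists [:: (x, y)]; rewrite big_seq1; split=> // a; rewrite inE => /eqP->. Qed.

Lemma word_le_prod (J : eqType) (s : seq J) g k : (forall j, j \in s -> word_le k (g j)) ->
  word_le (size s * k) (\prod_(j <- s) g j)%g.
Proof.
elim: s => [|j s IH] gk; first by rewrite big_nil; apply: word_le1.
rewrite big_cons mulSn; apply: word_leM; first by apply: gk; rewrite mem_head.
by apply: IH => j' j's; apply: gk; rewrite inE j's orbT.
Qed.

Lemma word_le_tperm2 x y z : e x y -> e y z -> x != y -> y != z -> x != z ->
  word_le 3 (tperm x z).
Proof.
move=> xy yz nxy nyz nxz.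
have -> : tperm x z = (tperm x y * (tperm y z * tperm x y))%g.
  rewrite -[X in (X * _)%g]tpermV -conjgE tpermJ tpermR tpermD //.
apply: (@word_leM 1 2); first exact: word_le_tperm.
by apply: (@word_leM 1 1); exact: word_le_tperm.
Qed.

Section Legs.
Variables (J : finType) (r : nat) (y : J -> nat -> V).
Hypothesis y_inj : forall i j k k', (k < r)%N -> (k' < r)%N ->
  y i k = y j k' -> i = j /\ k = k'.
Hypothesis y_adj : forall i k, (k.+1 < r)%N -> e (y i k) (y i k.+1).

Definition leg_swap (k : nat) : {perm V} := (\prod_(i <- enum J) tperm (y i k) (y i k.+1))%g.
Definition bubble (k : nat) : {perm V} := (\prod_(0 <= j < k) leg_swap j)%g.
Fixpoint reversal (k : nat) : {perm V} := if k is k'.+1 then (bubble k' * reversal k')%g else 1%g.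

Definition off_legs x := forall i k, (k < r)%N -> y i k != x.

Lemma y_neq i j k k' : (k < r)%N -> (k' < r)%N -> (i != j) || (k != k') -> y i k != y j k'.
Proof. by move=> kr k'r; apply: contraTneq => /(y_inj kr k'r)[-> ->]; rewrite !eqxx. Qed.

Lemma leg_swapE j i k : (j.+1 < r)%N -> (k < r)%N ->
  leg_swap j (y i k) = y i (if k == j then j.+1 else if k == j.+1 then j else k).
Proof.
move=> jr kr; apply: (prod_perm_single (k := i)); rewrite ?enum_uniq ?mem_enum //.
  case: eqP => [->|/eqP kj]; first by rewrite tpermL.
  case: eqP => [->|/eqP kj1]; first by rewrite tpermR.
  by rewrite tpermD // y_neq ?(ltnW jr) // eq_sym ?kj ?kj1 orbT.
move=> i' _ ii'; do 2?[case: eqP => _]; by rewrite !tpermD // y_neq ?(ltnW jr) ?ii'.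
Qed.

Lemma leg_swap_off j x : (j.+1 < r)%N -> off_legs x -> leg_swap j x = x.
Proof. by move=> jr xo; apply: prod_perm_fix => i _; rewrite tpermD ?xo // ltnW. Qed.

Lemma bubbleS k : bubble k.+1 = (bubble k * leg_swap k)%g.
Proof. by rewrite /bubble big_nat_recr. Qed.

Lemma bubbleE k i j : (k < r)%N -> (j < r)%N ->
  bubble k (y i j) = y i (if j == 0 then k else if (j <= k)%N then j.-1 else j).
Proof.
move=> + jr; elim: k => [|k IH] kr.
  by rewrite /bubble big_geq // perm1; case: j jr.
rewrite bubbleS permM IH ?(ltnW kr) //.
have kr' := ltnW kr.
case: j jr {IH} => [|j] jr /=; first by rewrite leg_swapE ?eqxx.
case: (leqP j.+1 k) => jk.
  by rewrite leg_swapE ?(ltnW jr) //; congr (y i _); do ?case: ifP; lia.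
by rewrite leg_swapE //; congr (y i _); do ?case: ifP; lia.
Qed.

Lemma bubble_off k x : (k < r)%N -> off_legs x -> bubble k x = x.
Proof.
move=> + xo; elim: k => [|k IH] kr; first by rewrite /bubble big_geq // perm1.
by rewrite bubbleS permM IH ?leg_swap_off // ltnW.
Qed.

Lemma reversalE k i j : (k <= r)%N -> (j < r)%N ->
  reversal k (y i j) = y i (if (j < k)%N then (k.-1 - j)%N else j).
Proof.
elim: k j => [|k IH] j kr jr /=; first by rewrite perm1.
rewrite permM bubbleE //; case: j jr => [|j] jr /=.
  by rewrite IH ?(ltnW kr) // ltnn subn0.
rewrite ltnS; case: (ltnP j k) => jk; rewrite IH ?(ltnW kr) ?(ltnW jr) //.
  by rewrite jk; congr (y i _); lia.
by rewrite ifN //; lia.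
Qed.

Lemma reversal_off k x : (k <= r)%N -> off_legs x -> reversal k x = x.
Proof.
move=> + xo; elim: k => [|k IH] kr /=; first by rewrite perm1.
by rewrite permM bubble_off // IH // ltnW.
Qed.

Lemma word_le_bubble k : (k < r)%N -> word_le (k * #|J|) (bubble k).
Proof.
move=> kr; rewrite -[X in (X * _)%N](subn0 k) -[X in (X * _)%N](size_iota 0).
rewrite /bubble /index_iota subn0.
apply: word_le_prod => j; rewrite mem_iota add0n => /andP[_ jk].
rewrite cardE -[X in word_le X]muln1; apply: word_le_prod => i _.
by apply/word_le_tperm/y_adj; lia.
Qed.

(* Each new token entering at the end [y i 0] of the legs is bubbled as far
   as possible, hence the reversal. *)
Lemma word_le_sweep c (z : nat -> nat -> {perm V}) (s k : nat) : (k <= r)%N ->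
  (forall s t k, (t < k)%N -> (k < r)%N -> (z s t.+1 ^ bubble k)%g = z s t) ->
  (forall s, word_le c (z s 0)) ->
  word_le (k * c + 'C(k, 2) * #|J|) ((\prod_(0 <= j < k) z (s + j) j) * reversal k)%g.
Proof.
move=> + zJ zc; elim: k s => [|k IH] s kr; first by rewrite big_geq // mul1g; apply: word_le1.
(* Moving [bubble k] to the left past the later exchanges lowers their depth by one, so that in the
   recursion every exchange is carried out at depth 0. *)
have -> : ((\prod_(0 <= j < k.+1) z (s + j) j) * reversal k.+1 =
  z s 0 * (bubble k * ((\prod_(0 <= j < k) z (s.+1 + j) j) * reversal k)))%g.
  rewrite big_nat_recl // addn0 /= -!mulgA; congr (_ * _)%g; rewrite !mulgA; congr (_ * _)%g.
  rewrite [LHS]conjgC conjg_prod; congr (_ * _)%g.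
  by apply: eq_big_nat => j /andP[_ jk]; rewrite zJ // addSnnS.
apply: word_le_trans (word_leM (zc s) (word_leM (word_le_bubble kr) (IH s.+1 (ltnW kr)))) _.
by rewrite binS bin1; lia.
Qed.

Lemma word_le_reversal k : (k <= r)%N -> word_le ('C(k, 2) * #|J|) (reversal k).
Proof.
move=> kr; have := @word_le_sweep 0 (fun _ _ => 1%g) 0 k kr.
rewrite muln0 add0n big1 // mul1g; apply; first by move=> *; rewrite conj1g.
by move=> _; exact: word_le1.
Qed.

End Legs.
End WordLength.

Lemma bin2_square k : (2 * 'C(k, 2) + k = k * k)%N.
Proof. by elim: k => [//|k IH]; rewrite binS bin1; lia. Qed.

(** * A cheap solution through the legs *)

Section UpperBound.
Variables (m h n : nat).

Local Notation r := (h.+2).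
Local Notation cvert := (cvert m h.*2.+1).
Local Notation vert := (vert m h n).
Local Notation word_le := (word_le (@vadj m h n)).

Definition rotation : {perm 'I_m.+1} := perm (can_inj (@ordSK m.+1)).

Variable ts : seq ('I_m.+1 * 'I_m.+1).
Hypothesis tsP : (\prod_(t <- ts) tperm t.1 t.2)%g = rotation.
Hypothesis ts_neq : all (fun t => t.1 != t.2) ts.

Definition leg (i : 'I_m.+1) (k : nat) : vert := inr (i, inord k).
(** The legs numbered from the clique, so that the sweep argument also applies at that end. *)
Definition leg_rev (i : 'I_m.+1) (k : nat) : vert := leg i (h.+1 - k).
Definition door (b : 'I_n.+1) (i : 'I_m.+1) (s : nat) : vert := inl ((b, inord s), inl i).

Lemma leg_inj i j k k' : (k < r)%N -> (k' < r)%N -> leg i k = leg j k' -> i = j /\ k = k'.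
Proof. by move=> kr k'r [-> /(congr1 val) /=]; rewrite !inordK. Qed.

Lemma leg_rev_inj i j k k' : (k < r)%N -> (k' < r)%N ->
  leg_rev i k = leg_rev j k' -> i = j /\ k = k'.
Proof. by move=> kr k'r /leg_inj[]; [lia|lia|move=> -> ?; split=> //; lia]. Qed.

Lemma door_inj b i j s s' : (s < r)%N -> (s' < r)%N -> door b i s = door b j s' -> i = j /\ s = s'.
Proof. by move=> sr s'r [/(congr1 val) /= + ->]; rewrite !inordK. Qed.

Lemma leg_adj i k : (k.+1 < r)%N -> vadj (leg i k) (leg i k.+1).
Proof. by move=> kr; rewrite /= eqxx !inordK ?eqxx // ltnW. Qed.

Lemma leg_rev_adj i k : (k.+1 < r)%N -> vadj (leg_rev i k) (leg_rev i k.+1).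
Proof.
move=> kr; rewrite vadj_sym /leg_rev (_ : h.+1 - k = (h.+1 - k.+1).+1)%N; last by lia.
by apply: leg_adj; lia.
Qed.

Lemma leg_surj q : inr q = leg q.1 q.2 :> vert.
Proof. by case: q => i s; rewrite /leg inord_val. Qed.

Local Notation rev1 := (reversal leg r).
Local Notation rev2 := (reversal leg_rev r).

Definition door_swap b s t : {perm vert} :=
  (\prod_(i <- enum 'I_m.+1) tperm (door b i s) (leg i t))%g.
Definition exchange b : {perm vert} := (\prod_(0 <= j < r) door_swap b j j)%g.
Definition hub_swap (t : nat) : {perm vert} :=
  (\prod_(p <- ts) tperm (leg_rev p.1 t) (leg_rev p.2 t))%g.
Definition hub : {perm vert} := (\prod_(0 <= j < r) hub_swap j)%g.
(** The two reversals cancel and the contents of leg [i] move to leg [ordS i]. They are kept because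
    each comes with a sweep: the first while the legs are filled from a block, the second while
    layers are permuted in the clique. *)
Definition shift : {perm vert} := (rev1 * hub * rev2)%g.
Definition rotate_block b : {perm vert} := (exchange b * shift * exchange b)%g.

Lemma door_swap_door b i s t : (s < r)%N -> (t < r)%N -> door_swap b s t (door b i s) = leg i t.
Proof.
move=> sr tr; apply: (prod_perm_single (k := i)); rewrite ?enum_uniq ?mem_enum ?tpermL //.
move=> j _ ji; rewrite !tpermD //.
- by apply: contraNneq ji => /(leg_inj tr tr)[->].
- by apply: contraNneq ji => /(door_inj sr sr)[->].
Qed.

Lemma door_swap_leg b i s t : (s < r)%N -> (t < r)%N -> door_swap b s t (leg i t) = door b i s.
Proof.
move=> sr tr; apply: (prod_perm_single (k := i)); rewrite ?enum_uniq ?mem_enum ?tpermR //.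
move=> j _ ji; rewrite !tpermD //.
- by apply: contraNneq ji => /(door_inj sr sr)[->].
- by apply: contraNneq ji => /(leg_inj tr tr)[->].
Qed.

Lemma door_swap_fix b s t x : (forall i, door b i s != x) -> (forall i, leg i t != x) ->
  door_swap b s t x = x.
Proof. by move=> dx lx; apply: prod_perm_fix => i _; rewrite tpermD. Qed.

Lemma exchange_door b i s : (s < r)%N -> exchange b (door b i s) = leg i s.
Proof.
move=> sr; apply: (prod_perm_single (k := s)); rewrite ?iota_uniq ?mem_index_iota //.
  exact: door_swap_door.
move=> j; rewrite mem_index_iota => /andP[_ jr] js; rewrite !door_swap_fix // => i'.
- by apply: contraNneq js => /(leg_inj jr sr)[_ ->].
- by apply: contraNneq js => /(door_inj jr sr)[_ ->].
Qed.

Lemma exchange_leg b i s : (s < r)%N -> exchange b (leg i s) = door b i s.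
Proof.
move=> sr; apply: (prod_perm_single (k := s)); rewrite ?iota_uniq ?mem_index_iota //.
  exact: door_swap_leg.
move=> j; rewrite mem_index_iota => /andP[_ jr] js; rewrite !door_swap_fix // => i'.
- by apply: contraNneq js => /(door_inj jr sr)[_ ->].
- by apply: contraNneq js => /(leg_inj jr sr)[_ ->].
Qed.

Lemma exchange_fix b x : (forall i s, door b i s != x) -> (forall i s, leg i s != x) ->
  exchange b x = x.
Proof. by move=> dx lx; apply: prod_perm_fix => j _; apply: door_swap_fix. Qed.

Lemma exchange_interior b a p : exchange b (inl (a, inr p)) = inl (a, inr p).
Proof. by apply: exchange_fix => // i s; apply/eqP => -[]. Qed.

Lemma exchange_other b b' i s : b != b' -> exchange b (door b' i s) = door b' i s.
Proof. by move=> bb'; apply: exchange_fix => // i' s'; apply: contraNneq bb' => -[->]. Qed.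

Lemma hub_swapE i t : (t < r)%N -> hub_swap t (leg_rev i t) = leg_rev (ordS i) t.
Proof.
move=> tr; have inj : injective (fun i => leg_rev i t) by move=> i' j /(leg_rev_inj tr tr)[].
by have := prod_tperm_image ts i inj; rewrite tsP permE.
Qed.

Lemma hub_swap_fix t x : (forall i, leg_rev i t != x) -> hub_swap t x = x.
Proof. by move=> lx; apply: prod_perm_fix => p _; rewrite tpermD. Qed.

Lemma hubE i t : (t < r)%N -> hub (leg_rev i t) = leg_rev (ordS i) t.
Proof.
move=> tr; apply: (prod_perm_single (k := t)); rewrite ?iota_uniq ?mem_index_iota //.
  exact: hub_swapE.
move=> j; rewrite mem_index_iota => /andP[_ jr] jt; rewrite !hub_swap_fix // => i';
  by apply: contraNneq jt => /(leg_rev_inj jr tr)[_ ->].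
Qed.

Lemma hub_fix u : hub (inl u) = inl u.
Proof. by apply: prod_perm_fix => j _; apply: hub_swap_fix. Qed.

Lemma shiftE x : shift x = rev2 (hub (rev1 x)).
Proof. by rewrite (permM (rev1 * hub)%g) (permM rev1). Qed.

Lemma rotate_blockE b x : rotate_block b x = exchange b (shift (exchange b x)).
Proof. by rewrite (permM (exchange b * shift)%g) (permM (exchange b)). Qed.

Lemma shift_leg i k : (k < r)%N -> shift (leg i k) = leg (ordS i) k.
Proof.
move=> kr; rewrite shiftE (reversalE leg_inj) // kr hubE // (reversalE leg_rev_inj) // kr.
by rewrite /leg_rev; congr (leg _ _); rewrite /=; lia.
Qed.

Lemma shift_fix u : shift (inl u) = inl u.
Proof. by rewrite shiftE (reversal_off (y := leg) (r := r)) // hub_fix (reversal_off (r := r)). Qed.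

Lemma prod_rotate_block : (\prod_(b <- enum 'I_n.+1) rotate_block b)%g = target m h n.
Proof.
have rotate_door b i s : (s < r)%N -> rotate_block b (door b i s) = door b (ordS i) s.
  by move=> sr; rewrite rotate_blockE exchange_door // shift_leg // exchange_leg.
have rotate_other b b' i s : b != b' -> rotate_block b (door b' i s) = door b' i s.
  by move=> bb'; rewrite rotate_blockE exchange_other // shift_fix exchange_other.
apply/permP => -[[[b s] [i|p]]|q].
- have E j : inl ((b, s), inl j) = door b j s by rewrite /door inord_val.
  rewrite permE /= !E; apply: (prod_perm_single (k := b)); rewrite ?enum_uniq ?mem_enum //.
    exact: rotate_door.
  by move=> b' _ bb'; rewrite !rotate_other.
- rewrite permE /=; apply: prod_perm_fix => b' _.
  by rewrite rotate_blockE exchange_interior shift_fix exchange_interior.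
- rewrite permE /=; apply: prod_perm_fix => b' _.
  by rewrite leg_surj rotate_blockE exchange_leg // shift_fix exchange_door.
Qed.

(** A sweep from the copies: the leg vertices of depth 0 are adjacent to all copies of their branch
    vertices, so each layer enters by [m.+1] edge swaps. *)
Lemma word_le_exchange_rev b : word_le (r * m.+1 + 'C(r, 2) * m.+1) (exchange b * rev1)%g.
Proof.
have := @word_le_sweep _ (@vadj m h n) _ r leg leg_adj m.+1 (door_swap b) 0 r (leqnn _).
rewrite card_ord; apply.
  move=> s t k tk kr; rewrite conjg_prod; apply: eq_bigr => i _.
  rewrite tpermJ (bubble_off (r := r)) // (bubbleE leg_inj) //; last by lia.
  by rewrite /= ifT.
move=> s; rewrite -[X in word_le X]muln1 -[X in (X * _)%N]card_ord cardE.
apply: word_le_prod => i _; apply: word_le_tperm; rewrite /= eqxx.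
by apply/eqP/val_inj; rewrite /= inordK.
Qed.

(** A sweep from the clique, where the transpositions [ts] are edge swaps that rotate one layer. *)
Lemma word_le_hub_rev : word_le (r * size ts + 'C(r, 2) * m.+1) (hub * rev2)%g.
Proof.
have := @word_le_sweep _ (@vadj m h n) _ r leg_rev leg_rev_adj (size ts)
  (fun _ => hub_swap) 0 r (leqnn _).
rewrite card_ord; apply.
  move=> s t k tk kr; rewrite conjg_prod; apply: eq_bigr => i _.
  rewrite tpermJ !(bubbleE leg_rev_inj) //; try by lia.
  by rewrite /= ifT.
move=> s; rewrite -[X in word_le X]muln1.
apply: word_le_prod => p pts; apply: word_le_tperm; rewrite /= (negPf (allP ts_neq p pts)).
by rewrite andbb; apply/eqP/val_inj; rewrite /= inordK // subn0.
Qed.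

Lemma word_le_exchange b : word_le (m.+1 * (r * r)) (exchange b).
Proof.
have := word_leM (word_le_exchange_rev b) (word_leV
  (@word_le_reversal _ (@vadj m h n) _ r leg leg_adj r (leqnn _))).
rewrite mulgK card_ord => /word_le_trans; apply.
by rewrite -bin2_square; lia.
Qed.

(** The binomials of the two sweeps and the [r * m.+1] entering swaps add up to [m.+1 * (r * r)],
    that is [m.+1 * r] per copy. *)
Lemma word_le_exchange_shift b :
  word_le (m.+1 * (r * r) + r * size ts) (exchange b * shift)%g.
Proof.
have -> : (exchange b * shift = (exchange b * rev1) * (hub * rev2))%g by rewrite /shift !mulgA.
apply: word_le_trans (word_leM (word_le_exchange_rev b) word_le_hub_rev) _.
by rewrite -bin2_square; lia.
Qed.

(** Conjugation by [exchange b'] replaces leg vertices by doors of [b'], so the tokens of two blocks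
    are exchanged directly. *)
Lemma exchangeJ b b' : b != b' -> (exchange b ^ exchange b' =
  \prod_(0 <= s < r) \prod_(i <- enum 'I_m.+1) tperm (door b i s) (door b' i s))%g.
Proof.
move=> bb'; rewrite conjg_prod; apply: eq_big_nat => s /andP[_ sr].
rewrite conjg_prod; apply: eq_bigr => i _.
by rewrite tpermJ exchange_other 1?eq_sym // exchange_leg.
Qed.

Lemma word_le_exchangeJ b b' : b != b' -> word_le (r * (m.+1 * 3)) (exchange b ^ exchange b')%g.
Proof.
move=> bb'; rewrite exchangeJ //.
rewrite -[X in word_le (X * _)](size_iota 0 r); apply: word_le_prod => s _.
rewrite -[X in word_le (X * _)]card_ord cardE; apply: word_le_prod => i _.
(* Two copies of a branch vertex have the first vertex of its leg as a common neighbour. *)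
apply: (@word_le_tperm2 _ (@vadj m h n) _ (leg i 0)) => //=.
- by rewrite eqxx; apply/eqP/val_inj; rewrite /= inordK.
- by rewrite eqxx; apply/eqP/val_inj; rewrite /= inordK.
- by apply: contraNneq bb' => -[->].
Qed.

Lemma exchangeJ_shift b b' : b != b' ->
  commute (exchange b ^ exchange b')%g shift.
Proof.
move=> bb'; apply/commgP/conjg_fixP; rewrite exchangeJ // conjg_prod.
apply: eq_bigr => s _; rewrite conjg_prod; apply: eq_bigr => i _.
by rewrite tpermJ !shift_fix.
Qed.

(* Emptying the legs into block [b] and refilling them from [b'] separately would
   be too expensive. But T_b T_b' = T_b' (T_b ^ T_b'), where the conjugate costs
   three swaps per token and commutes with [shift]. *)
Lemma word_le_blocks b bs : uniq (b :: bs) ->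
  word_le (size bs * (m.+1 * (r * r) + r * size ts + r * (m.+1 * 3)) + m.+1 * (r * r))
    (exchange b * \prod_(b' <- bs) rotate_block b')%g.
Proof.
elim: bs b => [|b' bs IH] b; first by rewrite big_nil mulg1 => _; apply: word_le_exchange.
move=> /= /andP[]; rewrite inE negb_or => /andP[bb' _] ubs.
rewrite big_cons.
have -> : (exchange b * (rotate_block b' * \prod_(j <- bs) rotate_block j) =
  exchange b' * shift *
    (exchange b ^ exchange b' * (exchange b' * \prod_(j <- bs) rotate_block j)))%g.
  have key (u x y c p : {perm vert}) : (x * y = y * u)%g -> commute u c ->
      (x * (y * c * y * p) = y * c * (u * (y * p)))%g.
    by move=> xy uc; rewrite !mulgA xy -(mulgA y u) uc !mulgA.
  by apply: key; [exact: conjgC|exact: exchangeJ_shift].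
apply: word_le_trans (word_leM (word_le_exchange_shift b')
  (word_leM (word_le_exchangeJ bb') (IH b' ubs))) _.
by rewrite (mulSn (size bs)); move: (size bs * _)%N => N; lia.
Qed.

Theorem word_le_target : word_le
  (n.+1 * (m.+1 * (r * r) + r * size ts + r * (m.+1 * 3)) + m.+1 * (r * r)) (target m h n).
Proof.
rewrite -prod_rotate_block.
have := enum_uniq 'I_n.+1; have := size_enum_ord n.+1.
case: (enum _) => [//|b bs] /= [sb] ub.
rewrite big_cons /rotate_block -(mulgA (_ * _)%g).
apply: word_le_trans (word_leM (word_le_exchange_shift b) (word_le_blocks ub)) _.
have -> : size bs = n by case: sb.
by rewrite (mulSn n); move: (n * _)%N => N; lia.
Qed.

End UpperBound.

(** * Comparison of the two bounds *)

Local Open Scope ring_scope.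

Lemma run_prod (R : realType) (I : instance R) (p : position I) (s : seq (vertex I * vertex I)) t :
  run p s t = (\prod_(e <- s) tperm e.1 e.2)%g (p t).
Proof.
elim: s p => [|e s IH] p; first by rewrite big_nil perm1.
by rewrite big_cons permM; exact: (IH (do_swap p e)).
Qed.

Lemma OPT_le (R : realType) (m h n k : nat) : word_le (@vadj m h n) k (target m h n) ->
  0 <= OPT (swap_instance R m h n) <= (2 * k)%:R.
Proof.
move=> [s [sk sadj sE]].
have [s0 s0valid [<- /(_ s) s0min]] := OPT_attained (swap_instance R m h n).
have svalid : @valid_solution R (swap_instance R m h n) s.
  by split=> // t; rewrite run_prod sE.
rewrite cost_unit // ler0n /= -(cost_unit _ s0valid) //.
by apply: le_trans (s0min svalid) _; rewrite cost_unit // ler_nat leq_mul2l.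
Qed.

Lemma exists_nat_ge (R : realType) (x : R) : exists k : nat, x <= k.+1%:R.
Proof. by exists (Num.truncn x); rewrite ltW // truncnS_gt. Qed.

(** Here [M] counts branch vertices, [B] blocks, [r] copies per block, [S] the transpositions in
    [ts], and [2 * r - 2] is the number of edges of a path. Both costs are compared with
    [B * M * (r * r)], each lower-order term being absorbed by a fraction [d / 20]. *)
Lemma asymptotic_gap (R : realType) (d M r B S : R) : 0 < d <= 1 -> 1 <= M ->
  0 <= S -> 0 < r -> 0 < B ->
  20 <= d * M -> 20 * (5 + 25 * M ^+ 2 + S) <= d * r -> 20 <= d * B ->
  (4 - d) * (2 * (B * (M * (r * r) + r * S + r * (M * 3)) + M * (r * r)))
    < 2 * (B * r * (2 * (M - 1) * (2 * r - 2 - 25 * M ^+ 2))).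
Proof.
case/andP => d_gt0 d_le1 M_ge1 S_ge0 r_gt0 B_gt0 dM dr dB.
have M_gt0 : 0 < M by lra.
have BMr : 0 < B * M * (r * r) by rewrite !mulr_gt0.
have hM : 0 <= (d * M - 20) * (B * (r * r)).
  by rewrite mulr_ge0 ?subr_ge0 // ltW // !mulr_gt0.
have hB : 0 <= (d * B - 20) * (M * (r * r)).
  by rewrite mulr_ge0 ?subr_ge0 // ltW // !mulr_gt0.
have hr : 0 <= (d * r - 20 * (5 + 25 * M ^+ 2 + S)) * (B * M * r).
  by rewrite mulr_ge0 ?subr_ge0 // ltW // !mulr_gt0.
have M2 : 0 <= M ^+ 2 by rewrite sqr_ge0.
have low : B * M * (r * r) * (8 - 12 * (d / 20))
    <= 2 * (B * r * (2 * (M - 1) * (2 * r - 2 - 25 * M ^+ 2))).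
  have a1 : (2 - d / 20) * r <= 2 * r - 2 - 25 * M ^+ 2 by lra.
  have a2 : (1 - d / 20) * M <= M - 1 by lra.
  have a3 : ((1 - d / 20) * M) * ((2 - d / 20) * r) <= (M - 1) * (2 * r - 2 - 25 * M ^+ 2).
    by apply: ler_pM => //; rewrite mulr_ge0 //; lra.
  have a4 : 4 * (B * r) * (((1 - d / 20) * M) * ((2 - d / 20) * r))
      <= 4 * (B * r) * ((M - 1) * (2 * r - 2 - 25 * M ^+ 2)).
    by rewrite ler_pM2l // mulr_gt0 // mulr_gt0.
  have a5 : 0 <= B * M * (r * r) * (d / 20) ^+ 2 by rewrite mulr_ge0 ?sqr_ge0 // ltW.
  by lra.
have up : B * (M * (r * r) + r * S + r * (M * 3)) + M * (r * r)
    <= B * M * (r * r) * (1 + 2 * (d / 20)).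
  have b1 : 0 <= S * (M - 1) * (B * r) by rewrite mulr_ge0 // ?mulr_ge0 ?subr_ge0 // ltW.
  have b2 : 0 <= M ^+ 2 * (B * M * r) by rewrite mulr_ge0 // ltW // !mulr_gt0.
  have b3 : 0 <= B * M * r by rewrite ltW // !mulr_gt0.
  by lra.
(* It remains to see that [(4 - d) * 2 * (1 + d / 10) < 8 - 3 * d / 5]. *)
apply: lt_le_trans low.
have d4 : 0 < 4 - d by lra.
apply: (@le_lt_trans _ _ ((4 - d) * (2 * (B * M * (r * r) * (1 + 2 * (d / 20)))))).
  by rewrite ler_pM2l // ler_pM2l.
have : 0 < B * M * (r * r) * d by rewrite mulr_gt0.
have : 0 <= B * M * (r * r) * d ^+ 2 by rewrite mulr_ge0 ?sqr_ge0 // ltW.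
by lra.
Qed.

Theorem theorem4 (R : realType) (delta : R) (delta_gt0 : 0 < delta) :
  ~ exists A : forall I : instance R, seq (vertex I * vertex I),
      forall I : instance R,
        [/\ gen_locally_optimal (A I),
            valid_solution (A I) &
            cost (A I) <=
              (2 + 2 * max_weight I / min_weight I - delta) * OPT I].
Proof.
case=> A HA.
(* The cap at 1 weakens the assumed ratio, as [OPT] is nonnegative, and keeps [4 - d] positive. *)
pose d := Num.min delta 1.
have d01 : 0 < d <= 1 by rewrite lt_min delta_gt0 ltr01 ge_min lexx orbT.
have [d_gt0 _] := andP d01.
(* The order of choices matters: [ts] depends on [m], and [h] must be large compared with [m] and
   [size ts]. *)
have [m mP] := exists_nat_ge (20 / d).
have [ts tsE ts_neq] := prod_tpermP (rotation m).
have [h hP] := exists_nat_ge (20 * (5 + 25 * m.+1%:R ^+ 2 + (size ts)%:R) / d).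
have [n nP] := exists_nat_ge (20 / d).
have [opt val] := HA (swap_instance R m h n).
have /andP[OPT_ge0 OPT_le_N] := OPT_le R (word_le_target h n (esym tsE) ts_neq).
have := local_size_ge opt val.
rewrite cost_unit // max_weight_unit // min_weight_unit // card_prod !card_ord => low up.
have {up} : (2 * size (A (swap_instance R m h n)))%:R <=
    (4 - d) * (2 * (n.+1 * (m.+1 * (h.+2 * h.+2) + h.+2 * size ts + h.+2 * (m.+1 * 3)) +
      m.+1 * (h.+2 * h.+2)))%:R :> R.
  apply: le_trans up _; rewrite mulr1 divr1 (_ : 2 + 2 = 4); last by lra.
  apply: (@le_trans _ _ ((4 - d) * OPT (swap_instance R m h n))).
    by rewrite ler_wpM2r // lerB // ge_min lexx.
  by rewrite ler_wpM2l //; lra.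
have {low} : (2 * (n.+1 * h.+2 * (2 * m * (h.*2.+1.+1 - 25 * m.+1 ^ 2))))%:R <=
    (2 * size (A (swap_instance R m h n)))%:R :> R.
  by rewrite ler_nat leq_mul2l.
move=> /le_trans H /H; apply/negP; rewrite -ltNge.
(* Truncated subtraction is at least the real difference, so the lower bound survives the passage to
   [R]. *)
have sub_ge (x y : nat) : x%:R - y%:R <= (x - y)%:R :> R.
  by case: (leqP x y) => [xy|/ltnW yx]; [rewrite (eqP xy) subr_le0 ler_nat|rewrite natrB].
apply: (@lt_le_trans _ _ (2 * (n.+1%:R * h.+2%:R *
  (2 * (m.+1%:R - 1) * (2 * h.+2%:R - 2 - 25 * m.+1%:R ^+ 2))))).
  rewrite !(natrM, natrD); apply: asymptotic_gap; rewrite ?ltr0n ?ler0n ?ler1n //.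
  - by rewrite [d * _]mulrC -ler_pdivrMr.
  - rewrite [d * _]mulrC -ler_pdivrMr //; apply: le_trans hP _; by rewrite ler_nat.
  - by rewrite [d * _]mulrC -ler_pdivrMr.
rewrite !natrM !ler_pM2l ?ltr0n ?mulr_gt0 ?ltr0n //.
rewrite (_ : m.+1%:R - 1 = m%:R); last by rewrite -natr1 addrK.
rewrite -!mulrA ler_wpM2l // ler_wpM2l //.
apply: le_trans (sub_ge _ _); rewrite natrM natrX lerB //.
by rewrite -doubleS -mul2n natrM -[h.+2%:R]natr1; lra.
Qed.
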